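(* For any graph $G$, $T_G(2,1)=|\mathcal{SF}(G)|$, where $\mathcal{SF}(G)$ is the set of spanning forests of $G$.
   Context: Graphs are finite and simple: $G=(V(G),E(G))$ with $E(G)$ a set of unordered pairs of distinct vertices; the empty graph is allowed. $\mathrm{cc}(G)$ is the number of connected components of $G$. For $F\subseteq E(G)$, $G_{\mid F}$ is the graph with vertex set $V(G)$ and edge set $F$. The Tutte polynomial is $T_G(X,Y)=\sum_{F\subseteq E(G)} (X-1)^{\mathrm{cc}(G_{\mid F})-\mathrm{cc}(G)} (Y-1)^{\mathrm{cc}(G_{\mid F})+|F|-|V(G)|}$, a polynomial over a field $\mathbb{K}$ of characteristic $0$. A spanning graph of $G$ is a graph $H$ with $V(H)=V(G)$ and $E(H)\subseteq E(G)$. A spanning forest of $G$ is a spanning graph of $G$ which is acyclic (no condition on the number of connected components). *)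

(* Defs.v *)
From HB Require Import structures.
From mathcomp Require Import all_boot all_order all_algebra.

Set Implicit Arguments.
Unset Strict Implicit.
Unset Printing Implicit Defensive.

Import GRing.Theory.

(* The vertex set of [G : graph V] is the whole finite type [V], which may be
   empty. *)
Record graph (V : finType) := Graph {
  edges : {set {set V}};
  edgesP : [forall e in edges, #|e| == 2]
}.

HB.instance Definition _ (V : finType) := [isSub for @edges V].
HB.instance Definition _ (V : finType) := [Countable of graph V by <:].
HB.instance Definition _ (V : finType) := [Finite of graph V by <:].

Definition adj (V : finType) (G : graph V) : rel V :=
  fun x y => [set x; y] \in edges G.

Lemma adj_sym (V : finType) (G : graph V) : symmetric (adj G).
Proof. by move=> x y; rewrite /adj setUC. Qed.

Lemma adj_irrefl (V : finType) (G : graph V) : irreflexive (adj G).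
Proof.
move=> x; apply/negP=> xG; have /forall_inP/(_ _ xG) := edgesP G.
by rewrite setUid cards1.
Qed.

Definition cc (V : finType) (G : graph V) : nat := n_comp (adj G) predT.

Lemma restrict_edgesP (V : finType) (G : graph V) (F : {set {set V}}) :
  [forall e in edges G :&: F, #|e| == 2].
Proof.
by apply/forall_inP=> e /setIP[eG _]; have /forall_inP/(_ _ eG) := edgesP G.
Qed.

(* The intersection only serves to make this total in [F]; see
   [edges_restrict]. *)
Definition restrict (V : finType) (G : graph V) (F : {set {set V}}) : graph V :=
  Graph (restrict_edgesP G F).

Lemma edges_restrict (V : finType) (G : graph V) (F : {set {set V}}) :
  F \subset edges G -> edges (restrict G F) = F.
Proof. by move/setIidPr. Qed.

(* Both exponents are nonnegative integers, so truncated subtraction on [nat]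
   is exact. *)
Definition tutte (K : fieldType) (V : finType) (G : graph V) : {poly {poly K}} :=
  (\sum_(F in powerset (edges G))
      ('X - 1) ^+ (cc (restrict G F) - cc G)%N *
      ('Y - 1) ^+ ((cc (restrict G F) + #|F|) - #|V|)%N)%R.

(* The vertices on a cycle are distinct, so bounding the length by [#|V|] loses
   nothing; see [acyclicP]. *)
Definition acyclic (V : finType) (G : graph V) : bool :=
  ~~ [exists c : #|V|.-bseq V, (2 < size c) && ucycleb (adj G) c].

Lemma acyclicP (V : finType) (G : graph V) :
  reflect (~ exists2 c : seq V, 2 < size c & ucycle (adj G) c) (acyclic G).
Proof.
apply: (iffP idP) => [/existsPn noc [c c2 cG] | noc].
  have cV : size c <= #|V| by case/andP: cG => _ /card_uniqP <-; apply: max_card.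
  by have /negP[] := noc (Bseq cV); rewrite /= c2.
by apply/existsPn=> c; apply/negP=> /andP[c2 cG]; apply: noc; exists c.
Qed.

Definition is_spanning_graph (V : finType) (G H : graph V) : bool :=
  edges H \subset edges G.

Definition spanning_forests (V : finType) (G : graph V) : {set graph V} :=
  [set H : graph V | is_spanning_graph G H & acyclic H].

(* Main.v *)
Require Import Defs.
From mathcomp Require Import all_boot all_order all_algebra.

Set Implicit Arguments.
Unset Strict Implicit.
Unset Printing Implicit Defensive.

(** Evaluating at [X = 2] and [Y = 1] turns the summand of [F] into
    [0 ^+ (cc (restrict G F) + #|F| - #|V|)], that is, into 1 when
    [cc (restrict G F) + #|F| <= #|V|] and into 0 otherwise. The theorem
    therefore reduces to the fact that a graph [H] on [V] is acyclic exactly when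
    [cc H + #|edges H| <= #|V|] ([acyclic_cc]), because taking edge sets is a
    bijection from the spanning forests of [G] to the [F] such that
    [restrict G F] is acyclic.

    This fact rests on the effect of deleting an edge [ab] on the number of
    components ([cc_delete]): it is unchanged if [a] and [b] remain connected,
    and increases by one otherwise. By induction on the number of edges,
    [#|V| <= cc H + #|edges H|] always holds, with equality when [H] is acyclic,
    since the ends of a deleted edge that remained connected would lie on a
    cycle. Conversely, deleting an edge of a cycle preserves the number of
    components, so that [#|V| <= cc H + #|edges H| - 1] when [H] has a cycle. *)

(** * Joining two points in a symmetric relation *)

Section AddPair.

Variables (T : finType) (e : rel T) (a b : T).
Hypothesis e_sym : symmetric e.

(** The symmetric relation obtained from [e] by joining [a] and [b]. *)
Definition add_pair : rel T := [rel x y | e x y || ([set x; y] == [set a; b])].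

Lemma add_pair_sym : symmetric add_pair.
Proof. by move=> x y; rewrite /add_pair /= e_sym setUC. Qed.

(* [z] lies in the component of [a] or in that of [b] *)
Let linked z := connect e z a || connect e z b.

Lemma connect_add_pair x y :
  connect add_pair x y = connect e x y || (linked x && linked y).
Proof.
have csym := sym_connect_sym e_sym.
have csym' := sym_connect_sym add_pair_sym.
apply/idP/idP.
  case/connectP=> p; elim: p x => [x _ -> | z p IHp x /= /andP[exz zp] ylast].
    by rewrite connect0.
  have {IHp ylast} zy := IHp z zp ylast.
  case/orP: exz => [exz | /eqP xz_ab].
    by rewrite /linked !(same_connect1 csym exz).
  have end_linked w : w \in [set a; b] -> linked w.
    by rewrite !inE /linked => /orP[]/eqP->; rewrite connect0 ?orbT.
  have zab : z \in [set a; b] by rewrite -xz_ab set22.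
  rewrite end_linked -?xz_ab ?set21 //=.
  case/orP: zy => [zy | /andP[_ ->]]; last by rewrite orbT.
  apply/orP; right; rewrite /linked csym [connect e y b]csym.
  by move: zab; rewrite !inE => /orP[]/eqP<-; rewrite zy ?orbT.
have sub u v : connect e u v -> connect add_pair u v.
  by apply: connect_sub => {}u {}v euv; rewrite connect1 // /add_pair /= euv.
have ab : connect add_pair a b by rewrite connect1 // /add_pair /= eqxx orbT.
have to_a z : linked z -> connect add_pair z a.
  by case/orP=> /sub // /connect_trans-> //; rewrite csym'.
case/orP=> [/sub // | /andP[/to_a xa /to_a ya]].
by rewrite (connect_trans xa) // csym'.
Qed.

(** When [a] and [b] are not connected, [root add_pair] restricts to a bijection
    from the roots of [e] other than the root of [b] to those of [add_pair]. *)
Lemma n_comp_add_pair :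
  n_comp e predT = n_comp add_pair predT + ~~ connect e a b.
Proof.
have csym := sym_connect_sym e_sym.
have csym' := sym_connect_sym add_pair_sym.
case: (boolP (connect e a b)) => [ab | nab].
  rewrite addn0; apply: eq_n_comp => x y; rewrite connect_add_pair.
  have linkedE z : linked z = connect e z a.
    by rewrite /linked -(same_connect_r csym ab) orbb.
  rewrite !linkedE; case: (boolP (connect e x y)) => //= nxy.
  apply/esym/negP=> /andP[xa ya]; case/negP: nxy.
  by rewrite (connect_trans xa) // csym.
rewrite addn1 /n_comp_mem.
have rE (f : rel T) : #|[predI roots f & predT]| = #|[set x | roots f x]|.
  by rewrite cardsE; apply: eq_card => x; rewrite !inE andbT.
rewrite !rE (cardsD1 (fingraph.root e b)) inE roots_root //= add1n; congr _.+1.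
set A := _ :\ _.
(* Among the roots in [A], only that of [a] lies in the merged component. *)
have A_linked x : x \in A -> linked x -> x = fingraph.root e a.
  rewrite !inE => /andP[xb /eqP xr] /orP[]; rewrite -(root_connect csym) xr.
    by move/eqP.
  by rewrite (negPf xb).
rewrite -(@card_in_imset _ _ (fingraph.root add_pair) (mem A))
  => [|x y xA yA /eqP].
  apply: eq_card => z; rewrite [RHS]inE; apply/imsetP/idP => [[x _ ->] | zr].
    exact: roots_root.
  have [zb | zb] := eqVneq (fingraph.root e z) (fingraph.root e b).
    exists (fingraph.root e a).
      by rewrite !inE roots_root // andbT (root_connect csym).
    rewrite -{1}(eqP zr); apply/eqP; rewrite root_connect // connect_add_pair.
    rewrite /linked -!(same_connect csym (connect_root e a)) connect0 /=.
    by rewrite -[connect e z b](root_connect csym) zb eqxx !orbT.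
  exists (fingraph.root e z); first by rewrite !inE zb roots_root.
  rewrite -{1}(eqP zr); apply/eqP; rewrite root_connect // connect_add_pair.
  by rewrite connect_root.
rewrite root_connect // connect_add_pair => /orP[|/andP[xl yl]].
  rewrite -(root_connect csym).
  by move: xA yA; rewrite !inE => /andP[_ /eqP->] /andP[_ /eqP->] /eqP.
by rewrite (A_linked x) // (A_linked y).
Qed.

End AddPair.

(** * Deleting an edge *)

(** The graph [H] without the pair [f], which need not be an edge of [H]. *)
Definition delete (V : finType) (H : graph V) (f : {set V}) : graph V :=
  restrict H (edges H :\ f).

Section Delete.

Variable V : finType.
Implicit Types (H : graph V) (a b : V) (f : {set V}).

Lemma edges_delete H f : edges (delete H f) = edges H :\ f.
Proof. by rewrite edges_restrict // subsetDl. Qed.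

Lemma adj_delete H f x y :
  adj (delete H f) x y = ([set x; y] != f) && adj H x y.
Proof. by rewrite /adj edges_delete !inE. Qed.

Lemma card_edges_delete H f :
  f \in edges H -> #|edges H| = #|edges (delete H f)|.+1.
Proof. by move=> fH; rewrite edges_delete (cardsD1 f (edges H)) fH. Qed.

Lemma cc_delete H a b : adj H a b ->
  let H' := delete H [set a; b] in
  cc H' = cc H + ~~ connect (adj H') a b.
Proof.
move=> ab H'; rewrite /cc (@n_comp_add_pair _ _ a b (@adj_sym _ _)).
congr (_ + _); apply: eq_n_comp; apply: eq_connect => x y.
rewrite /add_pair /= adj_delete; case: eqVneq => [xy | _] /=.
  by rewrite /adj xy.
by rewrite orbF.
Qed.

Lemma acyclic_delete H f : acyclic H -> acyclic (delete H f).
Proof.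
move/acyclicP=> noc; apply/acyclicP=> -[c c2 /andP[cH cU]]; apply: noc.
exists c => //; apply/andP; split=> //.
by apply: sub_cycle cH => x y; rewrite adj_delete => /andP[].
Qed.

(** A path avoiding the edge [ab] from [a] to [b] closes up into a cycle. *)
Lemma acyclic_disconnect H a b : acyclic H -> adj H a b ->
  ~~ connect (adj (delete H [set a; b])) a b.
Proof.
move/acyclicP=> noc ab; apply/negP=> /connectP[p0 p0P b_last].
case/shortenP: p0P b_last => p pP pU _ b_last; apply: noc.
have pH : path (adj H) a p.
  by apply: sub_path pP => x y; rewrite adj_delete => /andP[].
exists (a :: p); last first.
  by rewrite /ucycle pU andbT /= rcons_path pH -b_last adj_sym.
case: p pP {pU pH} b_last => [|x [|y p]] //= pP b_last.
  by move: ab; rewrite b_last adj_irrefl.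
by move: pP; rewrite -b_last adj_delete eqxx.
Qed.

(** The rest of a cycle through the edge [ab] connects [a] and [b]. *)
Lemma cyclic_connect H : ~~ acyclic H ->
  exists a b, adj H a b /\ connect (adj (delete H [set a; b])) a b.
Proof.
rewrite negbK => /existsP[[c _] /= /andP[]].
case: c => [|a [|b [|d p]]] //= _.
set q := d :: p => /andP[/= /andP[ab]].
rewrite -[_ && path _ _ _]/(path (adj H) b (rcons q a)) => bqa /and3P[aU bU _].
exists a, b; split=> //.
rewrite (sym_connect_sym (adj_sym _)).
apply/connectP; exists (rcons q a); last by rewrite last_rcons.
move: bqa; rewrite !rcons_path => /andP[bq qa].
(* The path from [b] through [q] avoids [a] until its last step, so no earlier
   step can be [ab]. *)
have not_ab x y : x != a -> y != a -> [set x; y] != [set a; b].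
  move=> xa ya; apply/eqP=> /setP/(_ a).
  by rewrite !inE eqxx eq_sym (negPf xa) eq_sym (negPf ya).
apply/andP; split.
  apply: (@sub_in_path _ (predC1 a) (adj H)) bq.
    by move=> x y; rewrite !inE => xa ya xy; rewrite adj_delete not_ab.
  by apply/allP=> x xbq /=; apply: contraNneq aU => <-.
(* The last step is not [ab] either: [q] is nonempty, so its last element, which
   precedes [a], differs from [b]. *)
rewrite adj_delete qa andbT; apply/eqP=> /setP/(_ b).
have ba : b != a by apply: contraNneq aU => ->; rewrite mem_head.
rewrite !inE eqxx orbT (negPf ba) orbF => /eqP b_last.
by move: bU; rewrite {1}b_last /= mem_last.
Qed.

End Delete.

(** * Counting the components of forests *)

Section Forests.

Variable V : finType.
Implicit Types H : graph V.

Lemma cc_edgeless H : edges H = set0 -> cc H = #|V|.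
Proof.
move=> H0; apply: eq_card => x; rewrite !inE andbT.
have /connectP[[|y p]] := connect_root (adj H) x; first by move=> _ /eqP.
by rewrite /= /adj H0 inE.
Qed.

Lemma edge_ends H f : f \in edges H -> exists a b, f = [set a; b].
Proof.
move=> fH; have /forall_inP/(_ _ fH)/cards2P[a [b [_ ->]]] := edgesP H.
by exists a, b.
Qed.

(** Induction on the number of edges of a graph. *)
Lemma edge_ind (P : graph V -> Prop) :
  (forall H, edges H = set0 -> P H) ->
  (forall H a b, adj H a b -> P (delete H [set a; b]) -> P H) ->
  forall H, P H.
Proof.
move=> P0 PS H; have [n] := ubnP #|edges H|; elim: n H => // n IHn H leHn.
have [/P0 // | [f fH]] := set_0Vmem (edges H).
have [a [b f_ab]] := edge_ends fH.
apply: (PS H a b); first by rewrite /adj -f_ab.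
by apply: IHn; rewrite -f_ab -ltnS -card_edges_delete.
Qed.

Lemma leq_card_cc H : #|V| <= cc H + #|edges H|.
Proof.
elim/edge_ind: H => [H /cc_edgeless-> | H a b ab]; first exact: leq_addr.
rewrite cc_delete // (@card_edges_delete _ H [set a; b]) // => /leq_trans-> //.
by rewrite -addnA leq_add2l -add1n leq_add2r leq_b1.
Qed.

Lemma cc_acyclic H : acyclic H -> cc H + #|edges H| = #|V|.
Proof.
elim/edge_ind: H => [H H0 _ | H a b ab IH acH].
  by rewrite cc_edgeless // H0 cards0 addn0.
rewrite -IH ?acyclic_delete // cc_delete // (acyclic_disconnect _ ab) //.
by rewrite (@card_edges_delete _ H [set a; b]) // -addnA.
Qed.

Lemma acyclic_cc H : acyclic H = (cc H + #|edges H| <= #|V|).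
Proof.
apply/idP/idP => [/cc_acyclic-> // |]; apply: contraTT => /cyclic_connect.
case=> a [b [ab con_ab]]; rewrite -ltnNge (@card_edges_delete _ H [set a; b]) //.
have := cc_delete ab; rewrite /= con_ab addn0 => <-.
by rewrite addnS ltnS leq_card_cc.
Qed.

Lemma card_spanning_forests (G : graph V) :
  #|spanning_forests G|
    = #|[set F in powerset (edges G) | acyclic (restrict G F)]|.
Proof.
rewrite -(card_imset _ (val_inj : injective (@edges V))).
apply: eq_card => F; rewrite !inE.
apply/imsetP/andP => [[H] | [FG acF]]; last first.
  exists (restrict G F); last by rewrite /= (setIidPr FG).
  by rewrite inE acF andbT /is_spanning_graph /= subsetIl.
rewrite inE => /andP[HG acH] ->; split=> //.
suff -> : restrict G (edges H) = H by [].
by apply: val_inj; apply: edges_restrict.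
Qed.

End Forests.

Theorem proposition3p3 (K : fieldType) (charK : ([pchar K]%R =i pred0))
    (V : finType) (G : graph V) :
  ((tutte K G).[2, 1] = #|spanning_forests G|%:R)%R.
Proof.
rewrite card_spanning_forests -sum1_card GRing.natr_sum /tutte.
rewrite !horner_sum big_mkcond [RHS]big_mkcond /=.
apply: eq_bigr => F _; rewrite [F \in [set _ in _ | _]]inE.
case: ifP => //=; rewrite inE => FG.
rewrite acyclic_cc edges_restrict // -subn_eq0.
set m := (_ - cc G)%N; set n := (_ - #|V|)%N.
rewrite !(hornerE, horner_exp).
rewrite GRing.subrr GRing.expr0n (_ : 2 - 1 = 1)%R ?GRing.addrK //.
by rewrite GRing.expr1n GRing.mul1r; case: (n == 0).
Qed.
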